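(* Let $k$ be a field and let $\mathcal{A}$ and $\mathcal{B}$ be additive $k$-categories that are symmetrically separably equivalent via functors $F:\mathcal{A}\to\mathcal{B}$ and $G:\mathcal{B}\to\mathcal{A}$. Let $\mathcal{A}'$ be a full additive subcategory of $\mathcal{A}$ and $\mathcal{B}'$ a full additive subcategory of $\mathcal{B}$ such that $F\mathcal{A}'\subseteq\mathcal{B}'$ and $G\mathcal{B}'\subseteq\mathcal{A}'$. Then the following pairs of categories are symmetrically separably equivalent: (a) $\mathcal{A}'$ and $\mathcal{B}'$; (b) $\mathcal{A}/\mathcal{A}'$ and $\mathcal{B}/\mathcal{B}'$; (c) $\operatorname{Fun}(\mathcal{A}/\mathcal{A}',\operatorname{mod} k)$ and $\operatorname{Fun}(\mathcal{B}/\mathcal{B}',\operatorname{mod} k)$.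
   Context: A $k$-category is a category enriched in $k$-vector spaces; functors between $k$-categories are $k$-linear. $\operatorname{mod} k$ is the category of finite dimensional $k$-vector spaces, and $\operatorname{Fun}(\mathcal{C},\operatorname{mod} k)$ is the category of ($k$-linear) functors $\mathcal{C}\to\operatorname{mod} k$ with natural transformations as morphisms. Additive $k$-categories $\mathcal{A}$ and $\mathcal{B}$ are symmetrically separably equivalent via $(F,G)$ if $F:\mathcal{A}\to\mathcal{B}$ and $G:\mathcal{B}\to\mathcal{A}$ are ($k$-linear) functors such that $(F,G)$ and $(G,F)$ are both adjoint pairs, the identity functor of $\mathcal{A}$ is a summand of $GF$, and the identity functor of $\mathcal{B}$ is a summand of $FG$. Here $\mathrm{Id}$ is a summand of a functor $H$ if there are natural transformations $\mathrm{Id}\Rightarrow H\Rightarrow\mathrm{Id}$ with composite the identity. For a full additive subcategory $\mathcal{A}'$ of $\mathcal{A}$, the category $\mathcal{A}/\mathcal{A}'$ has the same objects as $\mathcal{A}$, and its morphisms are equivalence classes of morphisms of $\mathcal{A}$ under the relation: for $f,g\in\operatorname{Hom}_{\mathcal{A}}(X,Y)$, $f\sim g$ if and only if $f-g$ factors through an object of $\mathcal{A}'$. *)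

(* Defs.v *)
From mathcomp Require Import all_boot all_order all_algebra.
From mathcomp Require Import boolp.
Set Implicit Arguments. Unset Strict Implicit. Unset Printing Implicit Defensive.
Import GRing.Theory.
Local Open Scope ring_scope.

(* Not lmodType: all MathComp carriers share one fixed universe, which is too
   small for the natural transformations between functors into vectType
   unless the source category is small.  No smallness is assumed below. *)
Record kspace (k : fieldType) := KSpace {
  kcar :> Type;
  kzero : kcar;
  kopp : kcar -> kcar;
  kadd : kcar -> kcar -> kcar;
  kscale : k -> kcar -> kcar;
  kaddA : associative kadd;
  kaddC : commutative kadd;
  kadd0 : left_id kzero kadd;
  kaddN : left_inverse kzero kopp kadd;
  kscaleA : forall a b v, kscale a (kscale b v) = kscale (a * b) v;
  kscale1 : left_id 1 kscale;
  kscaleDr : forall a, {morph kscale a : u v / kadd u v};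
  kscaleDl : forall v a b,
    kscale (a + b) v = kadd (kscale a v) (kscale b v) }.

Definition klinear (k : fieldType) (U V : kspace k) (f : U -> V) :=
  (forall u v, f (kadd u v) = kadd (f u) (f v)) /\
  (forall a u, f (kscale a u) = kscale a (f u)).

Definition ksub (k : fieldType) (V : kspace k) (u v : V) : V :=
  kadd u (kopp v).

Definition kspace_of_lmod (k : fieldType) (L : lmodType k) : kspace k :=
  @KSpace k L 0 -%R +%R *:%R (@addrA L) (@addrC L) (@add0r L) (@addNr L)
    (@scalerA k L) (@scale1r k L) (@scalerDr k L) (@scalerDl k L).

Section KspaceTheory.
Variables (k : fieldType) (V : kspace k).
Implicit Types u v w : V.

Lemma kaddI u v w : kadd u v = kadd u w -> v = w.
Proof.
by move=> e; rewrite -[v]kadd0 -(kaddN u) -kaddA e kaddA kaddN kadd0.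
Qed.

Lemma kaddr0 u : kadd u (kzero V) = u.
Proof. by rewrite kaddC kadd0. Qed.

Lemma ksubuu u : ksub u u = kzero V.
Proof. by rewrite /ksub kaddC kaddN. Qed.

Lemma kaddACA u v w z :
  kadd (kadd u v) (kadd w z) = kadd (kadd u w) (kadd v z).
Proof. by rewrite -!kaddA; congr kadd; rewrite !kaddA (kaddC v). Qed.

Lemma kscale0 v : kscale 0 v = kzero V.
Proof. by apply: (@kaddI (kscale 0 v)); rewrite -kscaleDl addr0 kaddr0. Qed.

Lemma koppE v : kopp v = kscale (-1) v.
Proof.
apply: (@kaddI v); rewrite -{3}[v]kscale1 -kscaleDl subrr kscale0.
by rewrite kaddC kaddN.
Qed.

Lemma kscaler0 a : kscale a (kzero V) = kzero V.
Proof.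
by apply: (@kaddI (kscale a (kzero V))); rewrite -kscaleDr kadd0 kaddr0.
Qed.

End KspaceTheory.

Section KlinearTheory.
Variables (k : fieldType) (U V : kspace k) (f : U -> V).
Hypothesis fL : klinear f.

Lemma klinear0 : f (kzero U) = kzero V.
Proof. by rewrite -(kscale0 (kzero U)) fL.2 kscale0. Qed.

Lemma klinearB u v : f (ksub u v) = ksub (f u) (f v).
Proof. by rewrite /ksub fL.1 !koppE fL.2. Qed.

End KlinearTheory.

Section Quotient.
Variables (k : fieldType) (V : kspace k) (W : V -> Prop).
Hypotheses (W0 : W (kzero V))
  (WD : forall u v, W u -> W v -> W (kadd u v))
  (WZ : forall a u, W u -> W (kscale a u)).

Definition qclass (u : V) : V -> Prop := fun v => W (ksub u v).

Definition quot_car := {c : V -> Prop | exists u, c = qclass u}.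

Definition qpi (u : V) : quot_car := exist _ (qclass u) (ex_intro _ u erefl).

Definition qrepr (c : quot_car) : V := sval (cid (proj2_sig c)).

Lemma qreprK c : qpi (qrepr c) = c.
Proof.
case: c => c hc; apply: eq_exist => /=.
by rewrite /qrepr; case: (cid _) => u /= ->.
Qed.

Lemma qpi_eq u v : qpi u = qpi v <-> W (ksub u v).
Proof.
have WN x y : W (ksub x y) -> W (ksub y x).
  move=> h; have -> : ksub y x = kscale (-1) (ksub x y).
    rewrite /ksub kscaleDr !koppE kscaleA mulrNN mulr1 kscale1.
    by rewrite kaddC.
  exact: WZ.
have WT x y z : W (ksub x y) -> W (ksub y z) -> W (ksub x z).
  move=> h1 h2; have -> : ksub x z = kadd (ksub x y) (ksub y z).
    by rewrite /ksub -kaddA [kadd (kopp y) _]kaddA kaddN kadd0.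
  exact: WD.
split=> [e|h].
  have := congr1 (fun c : quot_car => sval c v) e => /= {}e.
  by have : qclass u v by rewrite e /qclass ksubuu.
apply: eq_exist; apply: funext => w; apply: propext.
by split=> [|] hw; [apply: WT (WN _ _ h) hw | apply: WT h hw].
Qed.

Lemma qrepr_pi u : W (ksub (qrepr (qpi u)) u).
Proof. by apply/qpi_eq; rewrite qreprK. Qed.

Definition qadd c d := qpi (kadd (qrepr c) (qrepr d)).
Definition qopp c := qpi (kopp (qrepr c)).
Definition qscale a c := qpi (kscale a (qrepr c)).

Lemma qpiD u v : qpi (kadd u v) = qadd (qpi u) (qpi v).
Proof.
symmetry; apply/qpi_eq.
have -> : ksub (kadd (qrepr (qpi u)) (qrepr (qpi v))) (kadd u v)
  = kadd (ksub (qrepr (qpi u)) u) (ksub (qrepr (qpi v)) v).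
  by rewrite /ksub kaddACA !koppE kscaleDr.
exact: WD (qrepr_pi u) (qrepr_pi v).
Qed.

Lemma qpiZ a u : qpi (kscale a u) = qscale a (qpi u).
Proof.
symmetry; apply/qpi_eq.
have -> : ksub (kscale a (qrepr (qpi u))) (kscale a u)
  = kscale a (ksub (qrepr (qpi u)) u).
  by rewrite /ksub kscaleDr !koppE !kscaleA mulrC.
exact: WZ (qrepr_pi u).
Qed.

Lemma qaddA : associative qadd.
Proof.
move=> c d e; rewrite -[c]qreprK -[d]qreprK -[e]qreprK.
by rewrite -!qpiD kaddA.
Qed.

Lemma qaddC : commutative qadd.
Proof. by move=> c d; rewrite /qadd kaddC. Qed.

Lemma qadd0 : left_id (qpi (kzero V)) qadd.
Proof. by move=> c; rewrite -[c]qreprK -qpiD kadd0. Qed.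

Lemma qaddN : left_inverse (qpi (kzero V)) qopp qadd.
Proof. by move=> c; rewrite -{2}[c]qreprK -qpiD kaddN. Qed.

Lemma qscaleA a b c : qscale a (qscale b c) = qscale (a * b) c.
Proof. by rewrite -[c]qreprK -!qpiZ kscaleA. Qed.

Lemma qscale1 : left_id 1 qscale.
Proof. by move=> c; rewrite -[c]qreprK -qpiZ kscale1. Qed.

Lemma qscaleDr a : {morph qscale a : c d / qadd c d}.
Proof.
move=> c d; rewrite -[c]qreprK -[d]qreprK.
by rewrite -qpiD -!qpiZ -qpiD kscaleDr.
Qed.

Lemma qscaleDl c a b : qscale (a + b) c = qadd (qscale a c) (qscale b c).
Proof. by rewrite -[c]qreprK -!qpiZ -qpiD kscaleDl. Qed.

Definition kquot : kspace k :=
  KSpace qaddA qaddC qadd0 qaddN qscaleA qscale1 qscaleDr qscaleDl.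

End Quotient.

Record kcat (k : fieldType) := KCat {
  ob :> Type;
  hom : ob -> ob -> kspace k;
  idm : forall x, hom x x;
  comp : forall x y z, hom y z -> hom x y -> hom x z;
  comp_linl : forall x y z (f : hom x y),
    klinear (fun g : hom y z => comp g f);
  comp_linr : forall x y z (g : hom y z),
    klinear (fun f : hom x y => comp g f);
  compA : forall x y z t (h : hom z t) (g : hom y z) (f : hom x y),
    comp h (comp g f) = comp (comp h g) f;
  comp1m : forall x y (f : hom x y), comp (idm y) f = f;
  compm1 : forall x y (f : hom x y), comp f (idm x) = f }.

Arguments hom {k C} x y : rename.
Arguments idm {k C} x : rename.
Arguments comp {k C x y z} g f : rename.

Arguments comp_linl {k C x y z} f : rename.
Arguments comp_linr {k C x y z} g : rename.

Notation "g \oc f" := (comp g f) (at level 50, left associativity).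

Section CompTheory.
Variables (k : fieldType) (C : kcat k).

Lemma comp0m (x y z : C) (f : hom x y) : kzero (hom y z) \oc f = kzero _.
Proof. exact: (klinear0 (comp_linl f)). Qed.

Lemma compm0 (x y z : C) (g : hom y z) : g \oc kzero (hom x y) = kzero _.
Proof. exact: (klinear0 (comp_linr g)). Qed.

Lemma compBl (x y z : C) (f : hom x y) (g h : hom y z) :
  ksub g h \oc f = ksub (g \oc f) (h \oc f).
Proof. exact: (klinearB (comp_linl f)). Qed.

Lemma compBr (x y z : C) (g : hom y z) (f h : hom x y) :
  g \oc ksub f h = ksub (g \oc f) (g \oc h).
Proof. exact: (klinearB (comp_linr g)). Qed.

Lemma compDl (x y z : C) (f : hom x y) (g h : hom y z) :
  kadd g h \oc f = kadd (g \oc f) (h \oc f).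
Proof. exact: (comp_linl f).1. Qed.

Lemma compDr (x y z : C) (g : hom y z) (f h : hom x y) :
  g \oc kadd f h = kadd (g \oc f) (g \oc h).
Proof. exact: (comp_linr g).1. Qed.

Lemma compZl (x y z : C) (f : hom x y) a (g : hom y z) :
  kscale a g \oc f = kscale a (g \oc f).
Proof. exact: (comp_linl f).2. Qed.

Lemma compZr (x y z : C) (g : hom y z) a (f : hom x y) :
  g \oc kscale a f = kscale a (g \oc f).
Proof. exact: (comp_linr g).2. Qed.

End CompTheory.

Section Additive.
Variables (k : fieldType) (C : kcat k).

Definition is_zero_object (z : C) :=
  forall x : C, (exists f : hom x z, forall g, g = f) /\
                (exists f : hom z x, forall g, g = f).

Definition is_biproduct (x y s : C) (i1 : hom x s) (i2 : hom y s)
    (p1 : hom s x) (p2 : hom s y) :=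
  [/\ p1 \oc i1 = idm x, p2 \oc i2 = idm y,
      p2 \oc i1 = kzero _, p1 \oc i2 = kzero _ &
      kadd (i1 \oc p1) (i2 \oc p2) = idm s].

Definition additive_cat :=
  (exists z : C, is_zero_object z) /\
  (forall x y : C, exists (s : C) (i1 : hom x s) (i2 : hom y s)
     (p1 : hom s x) (p2 : hom s y), is_biproduct i1 i2 p1 p2).

End Additive.

Record kfunctor (k : fieldType) (C D : kcat k) := KFunctor {
  fob :> C -> D;
  fmor : forall x y, hom x y -> hom (fob x) (fob y);
  fmor_lin : forall x y, klinear (@fmor x y);
  fmor1 : forall x, fmor (idm x) = idm (fob x);
  fmorM : forall x y z (g : hom y z) (f : hom x y),
    fmor (g \oc f) = fmor g \oc fmor f }.

Arguments fmor {k C D} F {x y} f : rename.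

Section FunctorComp.
Variables (k : fieldType) (C D E : kcat k).

Definition id_functor : kfunctor C C.
Proof. by apply: (@KFunctor k C C id (fun x y f => f)). Defined.

Definition comp_functor (G : kfunctor D E) (F : kfunctor C D) : kfunctor C E.
Proof.
apply: (@KFunctor k C E (fun x => G (F x)) (fun x y f => fmor G (fmor F f))).
- move=> x y; split=> [u v|a u].
    by rewrite (fmor_lin F x y).1 (fmor_lin G _ _).1.
  by rewrite (fmor_lin F x y).2 (fmor_lin G _ _).2.
- by move=> x; rewrite !fmor1.
- by move=> x y z g f; rewrite !fmorM.
Defined.

End FunctorComp.

Record nattr (k : fieldType) (C D : kcat k) (F G : kfunctor C D) := NatTr {
  ntc :> forall x, hom (F x) (G x);
  ntP : forall x y (f : hom x y), ntc y \oc fmor F f = fmor G f \oc ntc x }.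

Section NatTransformations.
Variables (k : fieldType) (C D : kcat k).
Implicit Types F G H : kfunctor C D.

Lemma nattr_eq F G (s t : nattr F G) : (forall x, s x = t x) -> s = t.
Proof.
case: s t => [s sP] [t tP] /= e.
have est : s = t by apply: functional_extensionality_dep.
by subst t; congr NatTr; apply: Prop_irrelevance.
Qed.

Definition nat_id F : nattr F F.
Proof.
by exists (fun x => idm (F x)) => x y f; rewrite comp1m compm1.
Defined.

Definition nat_comp F G H (t : nattr G H) (s : nattr F G) : nattr F H.
Proof.
exists (fun x => t x \oc s x) => x y f.
by rewrite -compA ntP compA ntP compA.
Defined.

Definition nat_zero F G : nattr F G.
Proof.
exists (fun x => kzero _) => x y f.
by rewrite comp0m compm0.
Defined.

Definition nat_add F G (s t : nattr F G) : nattr F G.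
Proof.
exists (fun x => kadd (s x) (t x)) => x y f.
by rewrite compDl compDr !ntP.
Defined.

Definition nat_scale F G (a : k) (s : nattr F G) : nattr F G.
Proof.
exists (fun x => kscale a (s x)) => x y f.
by rewrite compZl compZr ntP.
Defined.

Definition nat_opp F G (s : nattr F G) : nattr F G.
Proof.
exists (fun x => kopp (s x)) => x y f.
by rewrite !koppE compZl compZr ntP.
Defined.

Definition nat_kspace F G : kspace k.
Proof.
apply: (@KSpace k (nattr F G) (nat_zero F G) (@nat_opp F G) (@nat_add F G)
  (@nat_scale F G)).
- by move=> s t u; apply: nattr_eq => x /=; rewrite kaddA.
- by move=> s t; apply: nattr_eq => x /=; rewrite kaddC.
- by move=> s; apply: nattr_eq => x /=; rewrite kadd0.
- by move=> s; apply: nattr_eq => x /=; rewrite kaddN.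
- by move=> a b s; apply: nattr_eq => x /=; rewrite kscaleA.
- by move=> s; apply: nattr_eq => x /=; rewrite kscale1.
- by move=> a s t; apply: nattr_eq => x /=; rewrite kscaleDr.
- by move=> s a b; apply: nattr_eq => x /=; rewrite kscaleDl.
Defined.

End NatTransformations.

Definition functor_cat (k : fieldType) (C D : kcat k) : kcat k.
Proof.
apply: (@KCat k (kfunctor C D) (@nat_kspace k C D) (@nat_id k C D)
  (@nat_comp k C D)).
- move=> F G H s; split=> [t u|a t]; apply: nattr_eq => x /=.
    exact: (comp_linl (s x)).1.
  exact: (comp_linl (s x)).2.
- move=> F G H t; split=> [s u|a s]; apply: nattr_eq => x /=.
    exact: (comp_linr (t x)).1.
  exact: (comp_linr (t x)).2.
- by move=> F G H K u t s; apply: nattr_eq => x /=; rewrite compA.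
- by move=> F G s; apply: nattr_eq => x /=; rewrite comp1m.
- by move=> F G s; apply: nattr_eq => x /=; rewrite compm1.
Defined.

Definition modk (k : fieldType) : kcat k.
Proof.
apply: (@KCat k (vectType k) (fun U V => kspace_of_lmod 'Hom(U, V))
  (fun U => \1%VF) (fun U V W g f => (g \o f)%VF)).
- move=> U V W f; split=> [g h|a g]; first exact: comp_lfunDl.
  exact: esym (comp_lfunZl _ _ _).
- move=> U V W g; split=> [f h|a f]; first exact: comp_lfunDr.
  exact: esym (comp_lfunZr _ _ _).
- by move=> U V W X h g f; apply: comp_lfunA.
- by move=> U V f; apply: comp_lfun1l.
- by move=> U V f; apply: comp_lfun1r.
Defined.

Section Equivalence.
Variables (k : fieldType).

(* Linearity of phi is automatic: naturality in y gives
   phi h = fmor G h \oc phi (idm (F x)). *)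
Definition adjoint_pair (A B : kcat k) (F : kfunctor A B) (G : kfunctor B A) :=
  exists phi : forall (x : A) (y : B), hom (F x) y -> hom x (G y),
  [/\ forall x y, bijective (@phi x y),
      forall x x' y (f : hom x' x) (h : hom (F x) y),
        phi x' y (h \oc fmor F f) = phi x y h \oc f &
      forall x y y' (g : hom y y') (h : hom (F x) y),
        phi x y' (g \oc h) = fmor G g \oc phi x y h].

Definition id_summand (C : kcat k) (H : kfunctor C C) :=
  exists (s : nattr (id_functor C) H) (r : nattr H (id_functor C)),
    nat_comp r s = nat_id (id_functor C).

Definition sym_sep_equiv_via (A B : kcat k)
    (F : kfunctor A B) (G : kfunctor B A) :=
  [/\ additive_cat A /\ additive_cat B,
      adjoint_pair F G, adjoint_pair G F,
      id_summand (comp_functor G F) & id_summand (comp_functor F G)].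

Definition sym_sep_equiv (A B : kcat k) :=
  exists (F : kfunctor A B) (G : kfunctor B A), sym_sep_equiv_via F G.

End Equivalence.

(* "Full additive subcategory" is rendered as additive_cat (full_subcat P);
   closure under isomorphisms or direct summands is not required. *)
Definition full_subcat (k : fieldType) (A : kcat k) (P : A -> Prop) : kcat k.
Proof.
apply: (@KCat k {x : A | P x} (fun x y => hom (sval x) (sval y))
  (fun x => idm (sval x)) (fun x y z g f => g \oc f)).
- by move=> x y z f; apply: comp_linl.
- by move=> x y z g; apply: comp_linr.
- by move=> x y z t h g f; apply: compA.
- by move=> x y f; apply: comp1m.
- by move=> x y f; apply: compm1.
Defined.

Definition factors_through (k : fieldType) (A : kcat k) (P : A -> Prop)
    (x y : A) (f : hom x y) :=
  exists z : A, P z /\ exists (b : hom z y) (a : hom x z), f = b \oc a.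

(* Zero object and biproducts in P make the morphisms factoring through P a
   subspace of each hom space, i.e. "f - g factors through P" a congruence. *)
Section QuotientCategory.
Variables (k : fieldType) (A : kcat k) (P : A -> Prop).
Hypothesis addP : additive_cat (full_subcat P).
Notation fact := (factors_through P).

Lemma fact0 x y : fact (kzero (hom x y)).
Proof.
case: addP => -[[z Pz] _] _; exists z; split=> //.
exists (kzero _), (kzero _).
by rewrite comp0m.
Qed.

Lemma factD x y (f g : hom x y) : fact f -> fact g -> fact (kadd f g).
Proof.
move=> [z [Pz [b [a ->]]]] [t [Pt [d [c ->]]]].
have [[s Ps] [/= i1 [i2 [p1 [p2 [/= e11 e22 e21 e12 _]]]]]] :=
  addP.2 (exist _ z Pz) (exist _ t Pt).
exists s; split=> //.
exists (kadd (b \oc p1) (d \oc p2)), (kadd (i1 \oc a) (i2 \oc c)).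
rewrite compDl !compDr -!compA.
rewrite ![p1 \oc (_ \oc _)]compA ![p2 \oc (_ \oc _)]compA e11 e22 e21 e12.
rewrite !comp1m !comp0m !compm0.
by rewrite kaddr0 kadd0.
Qed.

Lemma factZ x y a (f : hom x y) : fact f -> fact (kscale a f).
Proof.
move=> [z [Pz [b [c ->]]]]; exists z; split=> //.
by exists (kscale a b), c; rewrite compZl.
Qed.

Lemma fact_compl x y z (g : hom y z) (f : hom x y) : fact f -> fact (g \oc f).
Proof.
by move=> [t [Pt [b [a ->]]]]; exists t; split=> //; exists (g \oc b), a;
  rewrite compA.
Qed.

Lemma fact_compr x y z (g : hom y z) (f : hom x y) : fact g -> fact (g \oc f).
Proof.
by move=> [t [Pt [b [a ->]]]]; exists t; split=> //; exists b, (a \oc f);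
  rewrite compA.
Qed.

Definition qhom (x y : A) : kspace k :=
  kquot (fact0 x y) (@factD x y) (@factZ x y).

Definition hom_pi (x y : A) (f : hom x y) : qhom x y := qpi (@fact x y) f.

Definition qcomp (x y z : A) (g : qhom y z) (f : qhom x y) : qhom x z :=
  hom_pi (qrepr g \oc qrepr f).

Lemma hom_pi_eq x y (f g : hom x y) : hom_pi f = hom_pi g <-> fact (ksub f g).
Proof. exact: (qpi_eq (fact0 x y) (@factD x y) (@factZ x y)). Qed.

Lemma hom_piM x y z (g : hom y z) (f : hom x y) :
  hom_pi (g \oc f) = qcomp (hom_pi g) (hom_pi f).
Proof.
symmetry; apply/hom_pi_eq; set g' := qrepr _; set f' := qrepr _.
have hg : fact (ksub g' g) by apply/hom_pi_eq; exact: qreprK.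
have hf : fact (ksub f' f) by apply/hom_pi_eq; exact: qreprK.
have -> : ksub (g' \oc f') (g \oc f)
  = kadd (g' \oc ksub f' f) (ksub g' g \oc f).
  rewrite compBl compBr /ksub.
  by rewrite -kaddA [kadd (kopp _) (kadd _ _)]kaddA kaddN kadd0.
by apply: factD; [apply: fact_compl | apply: fact_compr].
Qed.

Lemma hom_pi_lin x y : klinear (@hom_pi x y).
Proof.
split=> [u v|a u]; first exact: (qpiD (fact0 x y) (@factD x y) (@factZ x y)).
exact: (qpiZ (fact0 x y) (@factD x y) (@factZ x y)).
Qed.

Lemma hom_pi_surj x y (c : qhom x y) : exists f, c = hom_pi f.
Proof. by exists (qrepr c); rewrite /hom_pi qreprK. Qed.

Definition quot_cat : kcat k.
Proof.
apply: (@KCat k A qhom (fun x => hom_pi (idm x)) qcomp).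
- move=> x y z c; have [f ->] := hom_pi_surj c.
  split=> [d e|a d].
    have [g ->] := hom_pi_surj d; have [h ->] := hom_pi_surj e.
    by rewrite -(hom_pi_lin _ _).1 -!hom_piM compDl (hom_pi_lin _ _).1.
  have [g ->] := hom_pi_surj d.
  by rewrite -(hom_pi_lin _ _).2 -!hom_piM compZl (hom_pi_lin _ _).2.
- move=> x y z c; have [f ->] := hom_pi_surj c.
  split=> [d e|a d].
    have [g ->] := hom_pi_surj d; have [h ->] := hom_pi_surj e.
    by rewrite -(hom_pi_lin _ _).1 -!hom_piM compDr (hom_pi_lin _ _).1.
  have [g ->] := hom_pi_surj d.
  by rewrite -(hom_pi_lin _ _).2 -!hom_piM compZr (hom_pi_lin _ _).2.
- move=> x y z t e d c; have [h ->] := hom_pi_surj e.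
  have [g ->] := hom_pi_surj d; have [f ->] := hom_pi_surj c.
  by rewrite -!hom_piM compA.
- by move=> x y c; have [f ->] := hom_pi_surj c; rewrite -hom_piM comp1m.
- by move=> x y c; have [f ->] := hom_pi_surj c; rewrite -hom_piM compm1.
Defined.

End QuotientCategory.

(* Main.v *)
From HB Require Import structures.
From mathcomp Require Import all_boot all_order all_algebra.
From mathcomp Require Import boolp.
Require Import Defs.
Set Implicit Arguments. Unset Strict Implicit. Unset Printing Implicit Defensive.
Import GRing.Theory.
Local Open Scope ring_scope.

(** A symmetric separable equivalence consists of natural transformations
    satisfying equations: a unit and a counit with the triangle identities for
    each of the adjunctions (F, G) and (G, F), and splittings Id => GF => Id
    and Id => FG => Id.  Such equational data survive every construction that
    is functorial in the category, the functors and the natural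
    transformations, and each of the three parts is one such construction.

    - Restriction to A' and B': the hypotheses F A' <= B' and G B' <= A' make
      F and G functors between the full subcategories, and fullness keeps the
      components of all the transformations.
    - Passage to A/A' and B/B': a functor that maps A' into B' maps a morphism
      factoring through A' to one factoring through B', so it descends to the
      quotients ([quot_functor]); a natural transformation descends by taking
      the classes of its components.
    - Precomposition, from functors C -> D to functors
      Fun(D, E) -> Fun(C, E): it reverses functors but not transformations,
      so an adjunction (F, G) becomes an adjunction (G^*, F^* )
      ([precomp_adjoint]).  The third part is this construction applied to the
      equivalence between the quotients, with E = mod k.

    Adjunctions are given by bijections of hom spaces, which are awkward to
    transport, hence the passage through units and counits
    ([unit_counit_of_adjoint], [adjoint_of_unit_counit]).  It remains to see
    that the new categories are additive.  Zero objects pass to quotients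
    because the hom spaces of a quotient are images of the old ones, and
    biproducts because they are given by equations; in functor categories
    both are formed pointwise. *)

(** * Units and counits of adjunctions *)

Lemma ntc_congr (k : fieldType) (C D : kcat k) (F G : kfunctor C D)
    (s t : nattr F G) : s = t -> forall x, s x = t x.
Proof. by move->. Qed.

Lemma fmor_retract (k : fieldType) (C D : kcat k) (H : kfunctor C D) (x y : C)
    (f : hom x y) (g : hom y x) :
  g \oc f = idm x -> fmor H g \oc fmor H f = idm (H x).
Proof. by move=> gf; rewrite -fmorM gf fmor1. Qed.

Section UnitCounit.
Variables (k : fieldType) (A B : kcat k).
Variables (F : kfunctor A B) (G : kfunctor B A).

(** Families of morphisms rather than natural transformations between composite
    functors: the objects are then the iterated values F (G y) in every
    equation, and the triangle identities typecheck cheaply when F and G are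
    concrete functors between functor categories. *)
Definition unit_counit_pair :=
  exists (eta : forall x, hom x (G (F x))) (eps : forall y, hom (F (G y)) y),
  [/\ forall x y (f : hom x y), eta y \oc f = fmor G (fmor F f) \oc eta x,
      forall x y (g : hom x y), eps y \oc fmor F (fmor G g) = g \oc eps x,
      forall x, eps (F x) \oc fmor F (eta x) = idm (F x) &
      forall y, fmor G (eps y) \oc eta (G y) = idm (G y)].

(** The unit is the image of the identity of F x; the counit is the preimage of
    the identity of G y.  Naturality gives phi h = G h \oc eta, and injectivity
    of phi reduces each identity about the counit to one about phi. *)
Lemma unit_counit_of_adjoint : adjoint_pair F G -> unit_counit_pair.
Proof.
move=> [phi [phi_bij phi_natl phi_natr]].
have phi_inj x y : injective (@phi x y) by apply: bij_inj.
have counit_ex y : exists h, phi (G y) y h = idm (G y).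
  by case: (phi_bij (G y) y) => psi _ psiK; exists (psi (idm (G y))).
pose eta x : hom x (G (F x)) := phi x (F x) (idm (F x)).
pose eps y : hom (F (G y)) y := sval (cid (counit_ex y)).
have phi_eps y : phi (G y) y (eps y) = idm (G y) by rewrite /eps; case: cid.
have phiE x y (h : hom (F x) y) : phi x y h = fmor G h \oc eta x.
  by rewrite -phi_natr compm1.
exists eta, eps; split=> [x y f|x y g|x|y].
- by rewrite -phi_natl comp1m phiE.
- by apply: phi_inj; rewrite phi_natl phi_natr !phi_eps comp1m compm1.
- by apply: phi_inj; rewrite phi_natl phi_eps comp1m.
- by rewrite -phiE phi_eps.
Qed.

(** The inverse of h |-> G h \oc eta is f |-> eps \oc F f; each triangle identity
    gives one of the two cancellations. *)
Lemma adjoint_of_unit_counit : unit_counit_pair -> adjoint_pair F G.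
Proof.
move=> [eta [eps [eta_nat eps_nat triF triG]]].
exists (fun x y h => fmor G h \oc eta x); split=> [x y|x x' y f h|x y y' g h].
- exists (fun f => eps y \oc fmor F f) => [h|f].
    by rewrite fmorM compA eps_nat -compA triF compm1.
  by rewrite fmorM -compA -eta_nat compA triG comp1m.
- by rewrite fmorM -!compA eta_nat.
- by rewrite fmorM compA.
Qed.

End UnitCounit.

(** * Restriction to full subcategories *)

Definition restrict_functor (k : fieldType) (A B : kcat k)
    (A' : A -> Prop) (B' : B -> Prop) (F : kfunctor A B)
    (FA' : forall x, A' x -> B' (F x)) :
  kfunctor (full_subcat A') (full_subcat B').
Proof.
apply: (@KFunctor k (full_subcat A') (full_subcat B')
  (fun x => exist _ (F (sval x)) (FA' _ (svalP x)))
  (fun x y f => @fmor k A B F (sval x) (sval y) f)).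
- by move=> x y; exact: (fmor_lin F (sval x) (sval y)).
- by move=> x; exact: (fmor1 F (sval x)).
- by move=> x y z g f; exact: (@fmorM k A B F (sval x) (sval y) (sval z) g f).
Defined.

Section FullSubcategories.
Variables (k : fieldType) (A B : kcat k) (A' : A -> Prop) (B' : B -> Prop).
Variables (F : kfunctor A B) (G : kfunctor B A).
Variables (FA' : forall x, A' x -> B' (F x)) (GB' : forall y, B' y -> A' (G y)).
Notation F' := (restrict_functor FA').
Notation G' := (restrict_functor GB').

Definition restrict_unit (u : nattr (id_functor A) (comp_functor G F)) :
  nattr (id_functor (full_subcat A')) (comp_functor G' F').
Proof.
exists (fun x : full_subcat A' => u (sval x)) => x y f.
exact: (@ntP k A A _ _ u (sval x) (sval y) f).
Defined.

Definition restrict_counit (v : nattr (comp_functor G F) (id_functor A)) :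
  nattr (comp_functor G' F') (id_functor (full_subcat A')).
Proof.
exists (fun x : full_subcat A' => v (sval x)) => x y f.
exact: (@ntP k A A _ _ v (sval x) (sval y) f).
Defined.

Lemma restrict_id_summand :
  id_summand (comp_functor G F) -> id_summand (comp_functor G' F').
Proof.
move=> [s [r rs]]; exists (restrict_unit s), (restrict_counit r).
by apply: nattr_eq => x; exact: (ntc_congr rs (sval x)).
Qed.

End FullSubcategories.

Lemma restrict_adjoint (k : fieldType) (A B : kcat k)
    (A' : A -> Prop) (B' : B -> Prop)
    (F : kfunctor A B) (G : kfunctor B A)
    (FA' : forall x, A' x -> B' (F x)) (GB' : forall y, B' y -> A' (G y)) :
  adjoint_pair F G ->
  adjoint_pair (restrict_functor FA') (restrict_functor GB').
Proof.
move=> /unit_counit_of_adjoint [eta [eps [eta_nat eps_nat triF triG]]].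
apply: adjoint_of_unit_counit.
exists (fun x => eta (sval x)), (fun y => eps (sval y)).
split=> [x y f|x y g|x|y].
- exact: (eta_nat _ _ f).
- exact: (eps_nat _ _ g).
- exact: triF.
- exact: triG.
Qed.

Lemma full_subcat_sym_sep_equiv (k : fieldType) (A B : kcat k)
    (F : kfunctor A B) (G : kfunctor B A)
    (A' : A -> Prop) (B' : B -> Prop)
    (addA' : additive_cat (full_subcat A'))
    (addB' : additive_cat (full_subcat B'))
    (FA' : forall x, A' x -> B' (F x)) (GB' : forall y, B' y -> A' (G y)) :
  sym_sep_equiv_via F G ->
  sym_sep_equiv_via (restrict_functor FA') (restrict_functor GB').
Proof.
move=> [_ adjFG adjGF sumA sumB]; split=> //.
- exact: restrict_adjoint.
- exact: restrict_adjoint.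
- exact: restrict_id_summand.
- exact: restrict_id_summand.
Qed.

(** * Passage to quotient categories *)

Section QuotientCategories.
Variables (k : fieldType) (A : kcat k) (A' : A -> Prop).
Hypothesis addA' : additive_cat (full_subcat A').

(** Hom spaces of the quotient are images of those of A, so uniqueness of maps
    to and from a zero object is inherited; the biproduct equations are
    preserved because taking classes is linear and multiplicative. *)
Lemma quot_additive : additive_cat A -> additive_cat (quot_cat addA').
Proof.
move=> [[z z0] biprod]; split.
  exists z => x; have [[f fU] [g gU]] := z0 x.
  split; [exists (hom_pi addA' f) => c | exists (hom_pi addA' g) => c].
    by have [h ->] := hom_pi_surj c; rewrite (fU h).
  by have [h ->] := hom_pi_surj c; rewrite (gU h).
move=> x y; have [s [i1 [i2 [p1 [p2 [e11 e22 e21 e12 eD]]]]]] := biprod x y.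
exists s, (hom_pi addA' i1), (hom_pi addA' i2), (hom_pi addA' p1),
  (hom_pi addA' p2).
split=> /=; rewrite -?hom_piM ?e11 ?e22 ?e21 ?e12 //.
by rewrite -eD; exact: esym ((hom_pi_lin addA' _ _).1 _ _).
Qed.

Variables (B : kcat k) (B' : B -> Prop).
Hypothesis addB' : additive_cat (full_subcat B').

Section QuotientFunctor.
Variable F : kfunctor A B.
Hypothesis FA' : forall x, A' x -> B' (F x).

(** The point where F A' <= B' is needed: it makes the functor induced on the
    quotients independent of representatives. *)
Lemma factors_through_fmor x y (f : hom x y) :
  factors_through A' f -> factors_through B' (fmor F f).
Proof.
move=> [z [A'z [b [a ->]]]]; exists (F z); split; first exact: FA'.
by exists (fmor F b), (fmor F a); rewrite fmorM.
Qed.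

Definition quot_fmor x y (c : qhom addA' x y) : qhom addB' (F x) (F y) :=
  hom_pi addB' (fmor F (qrepr c)).

Lemma quot_fmorE x y (f : hom x y) :
  quot_fmor (hom_pi addA' f) = hom_pi addB' (fmor F f).
Proof.
apply/hom_pi_eq; rewrite -(klinearB (fmor_lin F _ _)).
apply: factors_through_fmor.
by apply/(hom_pi_eq addA'); exact: qreprK.
Qed.

Lemma quot_fmor_lin x y : klinear (@quot_fmor x y).
Proof.
split=> [c d|a c]; have [f ->] := hom_pi_surj c.
  have [g ->] := hom_pi_surj d.
  rewrite -(hom_pi_lin addA' _ _).1 !quot_fmorE (fmor_lin F _ _).1.
  exact: (hom_pi_lin addB' _ _).1.
rewrite -(hom_pi_lin addA' _ _).2 !quot_fmorE (fmor_lin F _ _).2.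
exact: (hom_pi_lin addB' _ _).2.
Qed.

Definition quot_functor : kfunctor (quot_cat addA') (quot_cat addB').
Proof.
apply: (@KFunctor k (quot_cat addA') (quot_cat addB') F quot_fmor).
- exact: quot_fmor_lin.
- by move=> x /=; rewrite quot_fmorE fmor1.
- move=> x y z d c /=.
  have [g ->] := hom_pi_surj d; have [f ->] := hom_pi_surj c.
  by rewrite -hom_piM !quot_fmorE fmorM hom_piM.
Defined.

End QuotientFunctor.
End QuotientCategories.

Section QuotientTransformations.
Variables (k : fieldType) (A B : kcat k) (A' : A -> Prop) (B' : B -> Prop).
Variables (addA' : additive_cat (full_subcat A'))
  (addB' : additive_cat (full_subcat B')).
Variables (F : kfunctor A B) (G : kfunctor B A).
Variables (FA' : forall x, A' x -> B' (F x)) (GB' : forall y, B' y -> A' (G y)).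
Notation Fq := (quot_functor addA' addB' FA').
Notation Gq := (quot_functor addB' addA' GB').

Definition quot_unit (u : nattr (id_functor A) (comp_functor G F)) :
  nattr (id_functor (quot_cat addA')) (comp_functor Gq Fq).
Proof.
exists (fun x => hom_pi addA' (u x)) => x y c; have [f ->] := hom_pi_surj c.
rewrite /= (quot_fmorE _ _ FA') (quot_fmorE _ _ GB') -!hom_piM.
by have /= -> := ntP u f.
Defined.

Definition quot_counit (v : nattr (comp_functor G F) (id_functor A)) :
  nattr (comp_functor Gq Fq) (id_functor (quot_cat addA')).
Proof.
exists (fun x => hom_pi addA' (v x)) => x y c; have [f ->] := hom_pi_surj c.
rewrite /= (quot_fmorE _ _ FA') (quot_fmorE _ _ GB') -!hom_piM.
by have /= -> := ntP v f.
Defined.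

Lemma quot_id_summand :
  id_summand (comp_functor G F) -> id_summand (comp_functor Gq Fq).
Proof.
move=> [s [r rs]]; exists (quot_unit s), (quot_counit r).
apply: nattr_eq => x /=; rewrite -hom_piM.
by have /= -> := ntc_congr rs x.
Qed.

End QuotientTransformations.

Lemma quot_adjoint (k : fieldType) (A B : kcat k)
    (A' : A -> Prop) (B' : B -> Prop)
    (addA' : additive_cat (full_subcat A'))
    (addB' : additive_cat (full_subcat B'))
    (F : kfunctor A B) (G : kfunctor B A)
    (FA' : forall x, A' x -> B' (F x)) (GB' : forall y, B' y -> A' (G y)) :
  adjoint_pair F G ->
  adjoint_pair (quot_functor addA' addB' FA') (quot_functor addB' addA' GB').
Proof.
move=> /unit_counit_of_adjoint [eta [eps [eta_nat eps_nat triF triG]]].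
apply: adjoint_of_unit_counit.
exists (fun x => hom_pi addA' (eta x)), (fun y => hom_pi addB' (eps y)).
split=> [x y c|x y c|x|y] /=.
- have [f ->] := hom_pi_surj c.
  by rewrite (quot_fmorE _ _ FA') (quot_fmorE _ _ GB') -!hom_piM eta_nat.
- have [g ->] := hom_pi_surj c.
  by rewrite (quot_fmorE _ _ GB') (quot_fmorE _ _ FA') -!hom_piM eps_nat.
- by rewrite (quot_fmorE _ _ FA') -hom_piM triF.
- by rewrite (quot_fmorE _ _ GB') -hom_piM triG.
Qed.

Lemma quot_sym_sep_equiv (k : fieldType) (A B : kcat k)
    (F : kfunctor A B) (G : kfunctor B A)
    (A' : A -> Prop) (B' : B -> Prop)
    (addA' : additive_cat (full_subcat A'))
    (addB' : additive_cat (full_subcat B'))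
    (FA' : forall x, A' x -> B' (F x)) (GB' : forall y, B' y -> A' (G y)) :
  sym_sep_equiv_via F G ->
  sym_sep_equiv_via (quot_functor addA' addB' FA')
    (quot_functor addB' addA' GB').
Proof.
move=> [[addA addB] adjFG adjGF sumA sumB]; split.
- by split; apply: quot_additive.
- exact: quot_adjoint.
- exact: quot_adjoint.
- exact: quot_id_summand.
- exact: quot_id_summand.
Qed.

(** * Additivity of functor categories *)

Section FunctorCategoryAdditive.
Variables (k : fieldType) (C D : kcat k).

Section Zero.
Variables (z : D) (z0 : is_zero_object z).

Definition zero_functor : kfunctor C D.
Proof.
apply: (@KFunctor k C D (fun=> z) (fun x y f => kzero (hom z z))).
- by move=> x y; split=> [f g|a f]; rewrite ?kadd0 ?kscaler0.
(* the identity of a zero object is its zero endomorphism *)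
- by move=> x; have [[f fU] _] := z0 z; rewrite (fU (idm z)) (fU (kzero _)).
- by move=> x y w g f; rewrite comp0m.
Defined.

Lemma zero_functor_zero : is_zero_object (zero_functor : functor_cat C D).
Proof.
move=> H; split.
  exists (nat_zero H zero_functor) => t; apply: nattr_eq => x /=.
  by have [[f fU] _] := z0 (H x); rewrite (fU (t x)) (fU (kzero _)).
exists (nat_zero zero_functor H) => t; apply: nattr_eq => x /=.
by have [_ [f fU]] := z0 (H x); rewrite (fU (t x)) (fU (kzero _)).
Qed.

End Zero.

Section Biproduct.
Variables (H K : kfunctor C D) (S : C -> D).
Variables (i1 : forall x, hom (H x) (S x)) (i2 : forall x, hom (K x) (S x)).
Variables (p1 : forall x, hom (S x) (H x)) (p2 : forall x, hom (S x) (K x)).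
Hypothesis biprod : forall x, is_biproduct (i1 x) (i2 x) (p1 x) (p2 x).

(** The diagonal matrix with entries H f and K f.  It has to commute with the
    injections and projections: this makes them natural, and functoriality
    follows from the case of the injections. *)
Definition biprod_fmor x y (f : hom x y) : hom (S x) (S y) :=
  kadd (i1 y \oc fmor H f \oc p1 x) (i2 y \oc fmor K f \oc p2 x).

Lemma biprod_fmor_i1 x y (f : hom x y) :
  biprod_fmor f \oc i1 x = i1 y \oc fmor H f.
Proof.
have [e11 _ e21 _ _] := biprod x.
by rewrite compDl -!compA e11 e21 !compm0 compm1 kaddr0.
Qed.

Lemma biprod_fmor_i2 x y (f : hom x y) :
  biprod_fmor f \oc i2 x = i2 y \oc fmor K f.
Proof.
have [_ e22 _ e12 _] := biprod x.
by rewrite compDl -!compA e22 e12 !compm0 compm1 kadd0.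
Qed.

Lemma p1_biprod_fmor x y (f : hom x y) :
  p1 y \oc biprod_fmor f = fmor H f \oc p1 x.
Proof.
have [e11 _ _ e12 _] := biprod y.
by rewrite compDr !compA e11 e12 !comp0m comp1m kaddr0.
Qed.

Lemma p2_biprod_fmor x y (f : hom x y) :
  p2 y \oc biprod_fmor f = fmor K f \oc p2 x.
Proof.
have [_ e22 e21 _ _] := biprod y.
by rewrite compDr !compA e22 e21 !comp0m comp1m kadd0.
Qed.

Definition biprod_functor : kfunctor C D.
Proof.
apply: (@KFunctor k C D S biprod_fmor).
- move=> x y; split=> [f g|a f]; rewrite /biprod_fmor.
    by rewrite !(fmor_lin _ _ _).1 !compDr !compDl kaddACA.
  by rewrite !(fmor_lin _ _ _).2 !compZr !compZl kscaleDr.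
- move=> x; have [_ _ _ _ eD] := biprod x.
  by rewrite /biprod_fmor !fmor1 !compm1.
- move=> x y z g f; rewrite {3}/biprod_fmor compDr !compA.
  by rewrite biprod_fmor_i1 biprod_fmor_i2 /biprod_fmor !fmorM !compA.
Defined.

Lemma biprod_functorP :
  exists (j1 : nattr H biprod_functor) (j2 : nattr K biprod_functor)
    (q1 : nattr biprod_functor H) (q2 : nattr biprod_functor K),
  @is_biproduct k (functor_cat C D) H K biprod_functor j1 j2 q1 q2.
Proof.
exists (@NatTr k C D H biprod_functor i1
  (fun x y f => esym (biprod_fmor_i1 f))).
exists (@NatTr k C D K biprod_functor i2
  (fun x y f => esym (biprod_fmor_i2 f))).
exists (@NatTr k C D biprod_functor H p1 (@p1_biprod_fmor)).
exists (@NatTr k C D biprod_functor K p2 (@p2_biprod_fmor)).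
by split; apply: nattr_eq => x /=; have [] := biprod x.
Qed.

End Biproduct.

(** A chosen biproduct as a single object, so that one choice per object of C
    provides the sum together with its injections and projections. *)
Record biprod_data (a b : D) := BiprodData {
  bsum : D;
  binj1 : hom a bsum; binj2 : hom b bsum;
  bproj1 : hom bsum a; bproj2 : hom bsum b;
  bdataP : is_biproduct binj1 binj2 bproj1 bproj2 }.

Lemma functor_cat_additive : additive_cat D -> additive_cat (functor_cat C D).
Proof.
move=> [[z z0] biprod]; split.
  by exists (zero_functor z0); apply: zero_functor_zero.
move=> H K.
have data_ex x : exists d : biprod_data (H x) (K x), True.
  have [s [i1 [i2 [p1 [p2 h]]]]] := biprod (H x) (K x).
  by exists (BiprodData h).
pose d x := sval (cid (data_ex x)).
exists (biprod_functor (fun x => bdataP (d x))).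
exact: biprod_functorP.
Qed.

End FunctorCategoryAdditive.

(** * Precomposition *)

Section Precomposition.
Variables (k : fieldType) (C D E : kcat k).

Definition whisker (F : kfunctor C D) (H K : kfunctor D E) (t : nattr H K) :
  nattr (comp_functor H F) (comp_functor K F).
Proof.
by exists (fun x => t (F x)) => x y f; exact: (ntP t (fmor F f)).
Defined.

Definition precomp (F : kfunctor C D) :
  kfunctor (functor_cat D E) (functor_cat C E).
Proof.
apply: (@KFunctor k (functor_cat D E) (functor_cat C E)
  (fun H => comp_functor H F) (@whisker F)).
- by move=> H K; split=> [s t|a s]; apply: nattr_eq.
- by move=> H; apply: nattr_eq.
- by move=> H K L t s; apply: nattr_eq.
Defined.

End Precomposition.

Section PrecompositionTransformations.
Variables (k : fieldType) (C D E : kcat k).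
Variables (F : kfunctor C D) (G : kfunctor D C).

(** Whiskering with H, typed at the iterated composite (H G) F that
    precomposition with G and then with F produces, instead of H (G F). *)
Definition precomp_unit_at (u : nattr (id_functor C) (comp_functor G F))
    (H : kfunctor C E) : nattr H (comp_functor (comp_functor H G) F).
Proof.
exists (fun x => fmor H (u x)) => x y f.
by rewrite /= -!fmorM; congr fmor; exact: (ntP u f).
Defined.

Definition precomp_counit_at (v : nattr (comp_functor G F) (id_functor C))
    (H : kfunctor C E) : nattr (comp_functor (comp_functor H G) F) H.
Proof.
exists (fun x => fmor H (v x)) => x y f.
by rewrite /= -!fmorM; congr fmor; exact: (ntP v f).
Defined.

Definition precomp_unit (u : nattr (id_functor C) (comp_functor G F)) :
  nattr (id_functor (functor_cat C E))
    (comp_functor (precomp E F) (precomp E G)).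
Proof.
exists (precomp_unit_at u) => H K t.
by apply: nattr_eq => x /=; rewrite ntP.
Defined.

Definition precomp_counit (v : nattr (comp_functor G F) (id_functor C)) :
  nattr (comp_functor (precomp E F) (precomp E G))
    (id_functor (functor_cat C E)).
Proof.
exists (precomp_counit_at v) => H K t.
by apply: nattr_eq => x /=; rewrite ntP.
Defined.

Lemma precomp_id_summand : id_summand (comp_functor G F) ->
  id_summand (comp_functor (precomp E F) (precomp E G)).
Proof.
move=> [s [r rs]]; exists (precomp_unit s), (precomp_counit r).
apply: nattr_eq => H; apply: nattr_eq => x.
exact: (fmor_retract H (ntc_congr rs x)).
Qed.

End PrecompositionTransformations.

(** The unit of (F, G), whiskered with functors on C, is the unit of the new
    adjunction, and likewise for counits.  As precomposition reverses
    functors, the two adjoints change places and each triangle identity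
    follows from the other one. *)
Lemma precomp_adjoint (k : fieldType) (C D E : kcat k)
    (F : kfunctor C D) (G : kfunctor D C) :
  adjoint_pair F G -> adjoint_pair (precomp E G) (precomp E F).
Proof.
move=> /unit_counit_of_adjoint [eta [eps [eta_nat eps_nat triF triG]]].
pose u := @NatTr k C C (id_functor C) (comp_functor G F) eta eta_nat.
pose v := @NatTr k D D (comp_functor F G) (id_functor D) eps eps_nat.
apply: adjoint_of_unit_counit.
exists (precomp_unit_at u), (precomp_counit_at v).
split=> [H K t|H K t|H|H]; apply: nattr_eq => x.
- by rewrite /= ntP.
- by rewrite /= ntP.
- exact: (fmor_retract H (triG x)).
- exact: (fmor_retract H (triF x)).
Qed.

Lemma functor_cat_sym_sep_equiv (k : fieldType) (C D E : kcat k)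
    (F : kfunctor C D) (G : kfunctor D C) :
  additive_cat E -> sym_sep_equiv_via F G ->
  sym_sep_equiv_via (precomp E G) (precomp E F).
Proof.
move=> addE [_ adjFG adjGF sumC sumD]; split.
- by split; apply: functor_cat_additive.
- exact: precomp_adjoint.
- exact: precomp_adjoint.
- exact: precomp_id_summand.
- exact: precomp_id_summand.
Qed.

(** * Additivity of mod k *)

Lemma modk_additive (k : fieldType) : additive_cat (modk k).
Proof.
split.
  exists ('rV[k]_0 : vectType k) => V; split; exists (0 : 'Hom(_, _)) => /= f.
    by apply/lfunP => v; rewrite [LHS]thinmx0 [RHS]thinmx0.
  by apply/lfunP => v; rewrite [v]thinmx0 !linear0.
move=> U V.
have lin1 : linear (fun u : U => (u, 0 : V)).
  by move=> a u v; congr pair; rewrite /= scaler0 addr0.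
have lin2 : linear (fun v : V => (0 : U, v)).
  by move=> a u v; congr pair; rewrite /= scaler0 addr0.
pose f1 : {linear U -> (U * V)%type} := HB.pack (fun u : U => (u, 0 : V))
  (GRing.isLinear.Build k U (U * V)%type *:%R _ lin1).
pose f2 : {linear V -> (U * V)%type} := HB.pack (fun v : V => (0 : U, v))
  (GRing.isLinear.Build k V (U * V)%type *:%R _ lin2).
(* i1 and i2 are kept abstract: simplification would turn f1 and f2 into bare
   functions without their linear structure *)
have [i1 i1E] : exists i1 : 'Hom(U, (U * V)%type), forall u, i1 u = (u, 0).
  by exists (linfun f1) => u; rewrite lfunE.
have [i2 i2E] : exists i2 : 'Hom(V, (U * V)%type), forall v, i2 v = (0, v).
  by exists (linfun f2) => v; rewrite lfunE.
exists ((U * V)%type : vectType k), i1, i2, (linfun fst), (linfun snd).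
split; apply/lfunP => u; rewrite /= ?add_lfunE !comp_lfunE ?i1E ?i2E !lfunE //=.
by case: u => u v; congr pair; rewrite /= ?addr0 ?add0r.
Qed.

Theorem theorem3 (k : fieldType) (A B : kcat k)
    (F : kfunctor A B) (G : kfunctor B A)
    (hFG : sym_sep_equiv_via F G)
    (A' : ob A -> Prop) (B' : ob B -> Prop)
    (addA' : additive_cat (full_subcat A'))
    (addB' : additive_cat (full_subcat B'))
    (FA' : forall x : A, A' x -> B' (F x))
    (GB' : forall y : B, B' y -> A' (G y)) :
  [/\ sym_sep_equiv (full_subcat A') (full_subcat B'),
      sym_sep_equiv (quot_cat addA') (quot_cat addB') &
      sym_sep_equiv (functor_cat (quot_cat addA') (modk k))
                    (functor_cat (quot_cat addB') (modk k))].
Proof.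
have hq := quot_sym_sep_equiv addA' addB' FA' GB' hFG.
split.
- exists (restrict_functor FA'), (restrict_functor GB').
  exact: full_subcat_sym_sep_equiv.
- by exists (quot_functor addA' addB' FA'), (quot_functor addB' addA' GB').
- exists (precomp (modk k) (quot_functor addB' addA' GB')).
  exists (precomp (modk k) (quot_functor addA' addB' FA')).
  exact: functor_cat_sym_sep_equiv (modk_additive k) hq.
Qed.
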